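(* For every $k\ge 2$, rumor spreading in the complete graph on $n$ nodes with the $k$-PUSH&PULL protocol requires $\Omega(\log_k n)$ rounds with high probability.
   Context: The $k$-PUSH&PULL protocol on a graph: initially one arbitrary node knows a rumor (is informed). The process proceeds in synchronous rounds. In each round every node independently samples $k$ of its neighbors uniformly at random with replacement; every informed node sends the rumor to all the neighbors it sampled (push), and, simultaneously, every uninformed node requests the rumor from all the neighbors it sampled and becomes informed if at least one of them was informed at the start of the round (pull). Informed nodes stay informed. Rumor spreading is completed when all nodes are informed; the number of rounds required is the first round after which this holds. The number $k$ may depend on $n$. A statement holds with high probability (w.h.p.) if it holds with probability at least $1-n^{-c}$, where $c>0$ is a constant hidden in the asymptotic notation (i.e. for every constant $c>0$ the statement holds with probability at least $1-n^{-c}$ for a suitable implied constant depending only on $c$, in particular not on $k$). *)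

(* Defs.v *)
From HB Require Import structures.
From mathcomp Require Import all_boot all_order all_algebra.
From mathcomp Require Import all_classical all_reals all_analysis.

Set Implicit Arguments.
Unset Strict Implicit.
Unset Printing Implicit Defensive.

Import Order.TTheory GRing.Theory Num.Theory.
Import numFieldNormedType.Exports.

Local Open Scope classical_set_scope.
Local Open Scope ring_scope.

Definition complete_graph (V : finType) : rel V := fun u v => u != v.

Section Protocol.
Variables (V : finType) (k : nat).

(* [c v j] is the [j]-th node sampled by [v] in the round, [I] the set of nodes
   informed at the start of the round. *)
Definition pushed (I : {set V}) (c : V -> 'I_k -> V) : {set V} :=
  [set u | [exists v in I, [exists j, c v j == u]]]%SET.

Definition pulled (I : {set V}) (c : V -> 'I_k -> V) : {set V} :=
  [set u | (u \notin I) && [exists j, c u j \in I]]%SET.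

Definition push_pull_round (I : {set V}) (c : V -> 'I_k -> V) : {set V} :=
  (I :|: pushed I c :|: pulled I c)%SET.

Fixpoint informed (s : V) (c : nat -> V -> 'I_k -> V) (t : nat) : {set V} :=
  if t is t'.+1 then push_pull_round (informed s c t') (c t') else [set s]%SET.

(* The first [t] such that all nodes are informed after [t] rounds;
   [+oo] if there is none. *)
Definition spreading_time (R : realType) (s : V) (c : nat -> V -> 'I_k -> V) :
    \bar R :=
  ereal_inf [set (t%:R)%:E | t in [set t : nat | informed s c t = [set: V]%SET]].

End Protocol.

(* Random elements of a finite type, which carries the discrete sigma-algebra. *)
Definition finite_measurable d (T : measurableType d) (V : finType)
    (X : T -> V) : Prop :=
  forall A : set V, measurable (X @^-1` A).

Definition mutually_independent d (T : measurableType d) (R : realType)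
    (P : probability T R) (J : eqType) (V : finType) (X : J -> T -> V) : Prop :=
  forall (r : seq J) (A : J -> set V), uniq r ->
    P (\bigcap_(i in [set i | i \in r]) (X i @^-1` A i))
    = (\prod_(i <- r) P (X i @^-1` A i))%E.

(* [X t v j w] is the [j]-th neighbor sampled by node [v] in round [t] under
   the outcome [w], in the graph with adjacency relation [e]. *)
Definition neighbor_samples d (T : measurableType d) (R : realType)
    (P : probability T R) (V : finType) (e : rel V) (k : nat)
    (X : nat -> V -> 'I_k -> T -> V) : Prop :=
  [/\ forall t v j, finite_measurable (X t v j),
      forall t v j u, P (X t v j @^-1` [set u])
        = (if e v u then (#|e v|%:R)^-1 else 0)%:E &
      mutually_independent P
        (fun i : nat * V * 'I_k => X i.1.1 i.1.2 i.2)].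

Definition push_pull_time d (T : measurableType d) (R : realType) (V : finType)
    (k : nat) (X : nat -> V -> 'I_k -> T -> V) (s : V) : T -> \bar R :=
  fun w => spreading_time R s (fun t v j => X t v j w).

(* Main.v *)
(* In one round a set I of informed nodes pushes the rumor to at most k #|I|
   nodes, and the number of pulls hitting I is a sum of n k independent
   indicators of mean at most #|I| / (n - 1).  Hence
   E exp (l #|I_(t+1)|) <= E exp (l (1 + 5 k) #|I_t|) for 0 <= l <= 1/2, and
   l = (1 + 5 k)^-t / 2 yields P (#|I_t| = n) <= exp ((1 - n (1 + 5 k)^-t) / 2).
   Since 1 + 5 k <= k^4, this is at most exp ((1 - sqrt n) / 2) as long as
   t <= log_k n / 8.  For n too small for that to be at most n^-c, the constant C
   makes C log_k n <= 1, and one node never suffices to cover the graph. *)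

Require Import Defs.
From HB Require Import structures.
From mathcomp Require Import all_boot all_order all_algebra.
From mathcomp Require Import all_classical all_reals all_analysis.
From mathcomp Require Import ring lra.

Set Implicit Arguments.
Unset Strict Implicit.
Unset Printing Implicit Defensive.

Import Order.TTheory GRing.Theory Num.Theory.
Import numFieldNormedType.Exports.

Local Open Scope classical_set_scope.
Local Open Scope ring_scope.

(** * The informed set as a Markov chain driven by independent samples *)

Lemma measure_fibers (R : realType) (d : measure_display) (T : measurableType d)
    (P : probability T R) (Q : finType) (f : T -> Q) (A : set T) :
  (forall q, measurable (A `&` f @^-1` [set q])) ->
  P A = (\sum_(q : Q) P (A `&` f @^-1` [set q]))%E.
Proof.
move=> mAf.
have {1}-> : A = \bigcup_(q in [set` index_enum Q]) (A `&` f @^-1` [set q]).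
  apply/seteqP; split=> [w Aw|w [q _ []//]]; exists (f w) => //=.
  exact: mem_index_enum.
rewrite measure_fin_bigcup //; last exact: trivIset_preimage1_in.
by rewrite -fsbig_seq ?index_enum_uniq.
Qed.

Section InformedLaw.
Variables (R : realType) (d : measure_display) (T : measurableType d).
Variables (P : probability T R) (V : finType) (e : rel V) (k : nat).
Variables (X : nat -> V -> 'I_k -> T -> V) (s : V).
Hypothesis samplesX : neighbor_samples P e X.

Let ix : Type := (nat * V * 'I_k)%type.

Definition informed_at (t : nat) (w : T) : {set V} :=
  informed s (fun t v j => X t v j w) t.

Definition informed_event (t : nat) (B : {set V}) : set T :=
  informed_at t @^-1` [set B].

(** Has the same shape as the events in [mutually_independent], so that independence applies to it
    verbatim. [A] is total, but only its values on [r] matter. *)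
Definition cylinder (r : seq ix) (A : ix -> set V) : set T :=
  \bigcap_(i in [set i | i \in r]) (X i.1.1 i.1.2 i.2 @^-1` A i).

Lemma measurable_cylinder r A : measurable (cylinder r A).
Proof.
apply: fin_bigcap_measurable => [|i _]; first exact: finite_seq.
by case: samplesX => mX _ _; apply: mX.
Qed.

Definition round_samples (t : nat) (w : T) : {ffun V * 'I_k -> V} :=
  [ffun i => X t i.1 i.2 w].

Definition next_informed (B : {set V}) (o : {ffun V * 'I_k -> V}) : {set V} :=
  push_pull_round B (fun v j => o (v, j)).

Lemma informed_next t w :
  informed_at t.+1 w = next_informed (informed_at t w) (round_samples t w).
Proof.
rewrite /next_informed /informed_at /=; congr push_pull_round.
by apply/funext => v; apply/funext => j; rewrite ffunE.
Qed.

Lemma round_samples_fiber t o :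
  round_samples t @^-1` [set o]
  = cylinder [seq (t, i.1, i.2) | i <- enum {: V * 'I_k}]
      (fun i => [set o (i.1.2, i.2)]).
Proof.
apply/seteqP; split=> [w /= <- _ /mapP[[v j] _ ->] /=|w cw]; first by rewrite ffunE.
apply/ffunP => -[v j]; rewrite ffunE /=.
by apply: (cw (t, v, j)); apply/mapP; exists (v, j); rewrite ?mem_enum.
Qed.

Lemma measurable_round_samples t o : measurable (round_samples t @^-1` [set o]).
Proof. rewrite round_samples_fiber; exact: measurable_cylinder. Qed.

(** The current informed set and the samples of the round determine the next informed set, so each
    fiber lies either entirely inside the event or entirely outside it. *)
Lemma informed_event_fiber t B q :
  informed_event t.+1 B `&`
    (fun w => (informed_at t w, round_samples t w))
      @^-1` [set q]
  = if next_informed q.1 q.2 == B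
    then informed_event t q.1 `&` round_samples t @^-1` [set q.2] else set0.
Proof.
case: q => I o /=; case: ifPn => [/eqP <-|ne].
  apply/seteqP; split=> w; rewrite /informed_event /preimage /= informed_next.
    by move=> [_ [-> ->]].
  by move=> [-> ->].
apply/seteqP; split=> w //; rewrite /informed_event /preimage /= informed_next.
by move=> [eB [eI eo]]; move: ne; rewrite -eB eI eo eqxx.
Qed.

Lemma informed_event0 B :
  informed_event 0 B = if [set s]%SET == B then setT else set0.
Proof.
rewrite /informed_event /preimage /informed_at /=.
by case: eqP => ne; apply/seteqP; split.
Qed.

Lemma measurable_informed_event t B : measurable (informed_event t B).
Proof.
elim: t B => [|t IH] B.
  by rewrite informed_event0; case: ifP.
pose f w := (informed_at t w, round_samples t w).
have -> : informed_event t.+1 B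
    = \bigcup_(q in [set: _]) (informed_event t.+1 B `&` f @^-1` [set q]).
  by apply/seteqP; split=> [w Bw|w [q _ []//]]; exists (f w).
apply: fin_bigcup_measurable => // q _; rewrite informed_event_fiber.
by case: ifP => // _; apply: measurableI => //; exact: measurable_round_samples.
Qed.

(** The extra event [S] lets the same decomposition serve twice: with later samples in the
    independence proof, and with [setT] for the transition formula. *)
Lemma informed_event_step t B (S : set T) : measurable S ->
  P (informed_event t.+1 B `&` S)
  = (\sum_(q : {set V} * {ffun V * 'I_k -> V} | next_informed q.1 q.2 == B)
      P (informed_event t q.1 `&` (round_samples t @^-1` [set q.2] `&` S)))%E.
Proof.
move=> mS.
pose f w := (informed_at t w, round_samples t w).
have fib q : informed_event t.+1 B `&` S `&` f @^-1` [set q]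
    = if next_informed q.1 q.2 == B
      then informed_event t q.1 `&` (round_samples t @^-1` [set q.2] `&` S)
      else set0.
  rewrite setIAC informed_event_fiber.
  by case: ifP => _; rewrite ?set0I // setIA.
rewrite (@measure_fibers _ _ _ P _ f); last first.
  move=> q; rewrite fib; case: ifP => // _.
  apply: measurableI; first exact: measurable_informed_event.
  by apply: measurableI => //; exact: measurable_round_samples.
rewrite [RHS]big_mkcond; apply: eq_bigr => q _; rewrite fib.
by case: ifP => // _; rewrite measure0.
Qed.

Definition sample_prob (v u : V) : R := if e v u then (#|e v|%:R)^-1 else 0.

Lemma probability_cylinder r A : uniq r ->
  P (cylinder r A) = (\prod_(i <- r) P (X i.1.1 i.1.2 i.2 @^-1` A i))%E.
Proof. by case: samplesX => _ _ indX; exact: indX. Qed.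

(** The informed set after [t] rounds depends only on rounds numbered below [t]. Arbitrary lists [r]
    are allowed because the induction moves the samples of one more round into the cylinder. *)
Lemma informed_indep t B r A : uniq r -> (forall i, i \in r -> (t <= i.1.1)%N) ->
  P (informed_event t B `&` cylinder r A)
  = (P (informed_event t B) * P (cylinder r A))%E.
Proof.
elim: t B r A => [|t IH] B r A ur tr.
  rewrite informed_event0; case: ifP => _.
    by rewrite setTI probability_setT mul1e.
  by rewrite set0I measure0 mul0e.
have rnd q : let c := round_samples t @^-1` [set q.2] in
    P (informed_event t q.1 `&` (c `&` cylinder r A))
    = (P (informed_event t q.1 `&` c) * P (cylinder r A))%E.
  move=> c; rewrite /c round_samples_fiber.
  set l := [seq _ | i <- _].
  have lt i : i \in l -> i.1.1 = t by move=> /mapP[[v j] _ ->].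
  have ul : uniq l.
    by rewrite map_inj_uniq ?enum_uniq // => -[v j] [v' j'] [-> ->].
  set A1 := (A1 in cylinder l A1).
  (* Here [r] only contains rounds after [t], so its constraints and those of round [t] never
     concern the same sample; testing the round merges them into one cylinder. *)
  pose A2 i := if i.1.1 == t then A1 i else A i.
  have -> : cylinder l A1 `&` cylinder r A = cylinder (l ++ r) A2.
    apply/seteqP; split=> [w [w1 w2] i|w wi].
      rewrite /= mem_cat /A2 => /orP[il|ir].
        by have := w1 i il; rewrite /= (lt i il) eqxx.
      by rewrite gtn_eqF ?tr //; have := w2 i ir.
    split=> i /= ii.
      have := wi i; rewrite /= mem_cat ii => /(_ isT).
      by rewrite /A2 (lt i ii) eqxx.
    have := wi i; rewrite /= mem_cat ii orbT => /(_ isT).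
    by rewrite /A2 gtn_eqF ?tr.
  (* The induction hypothesis is used on the merged cylinder, then on round [t] alone; the product
     formula for cylinders compares the two results. *)
  rewrite IH; last 2 first.
  - rewrite cat_uniq ul ur andbT /=; apply/hasPn => i /tr ti.
    by apply: contraTN ti => /lt ->; rewrite ltnn.
  - move=> i; rewrite mem_cat => /orP[/lt -> //|/tr]; exact: ltnW.
  rewrite IH //; last by move=> i /lt ->.
  rewrite -muleA; congr (_ * _)%E.
  rewrite !probability_cylinder ?big_cat //=; last first.
    rewrite cat_uniq ul ur andbT /=; apply/hasPn => i /tr ti.
    by apply: contraTN ti => /lt ->; rewrite ltnn.
  congr (_ * _)%E; rewrite big_seq [RHS]big_seq; apply: eq_bigr => i ii.
    by rewrite /A2 (lt i ii) eqxx.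
  by rewrite /A2 gtn_eqF ?tr.
have mS := measurable_cylinder r A.
rewrite informed_event_step // -[informed_event t.+1 B]setIT informed_event_step //.
rewrite ge0_sume_distrl //; apply: eq_bigr => q _.
by rewrite setIT rnd.
Qed.

Lemma informed_law t B :
  P (informed_event t.+1 B)
  = (\sum_(q : {set V} * {ffun V * 'I_k -> V} | next_informed q.1 q.2 == B)
      P (informed_event t q.1) *
        (\prod_i sample_prob i.1 (q.2 i))%:E)%E.
Proof.
rewrite -[informed_event t.+1 B]setIT informed_event_step //.
apply: eq_bigr => q _; rewrite setIT round_samples_fiber informed_indep.
- congr (_ * _)%E; rewrite probability_cylinder.
    rewrite big_map big_enum /= -prodEFin; apply: eq_bigr => -[v j] _ /=.
    by case: samplesX => _ -> _.
  by rewrite map_inj_uniq ?enum_uniq // => -[v j] [v' j'] [-> ->].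
- by rewrite map_inj_uniq ?enum_uniq // => -[v j] [v' j'] [-> ->].
- by move=> _ /mapP[i _ ->].
Qed.

End InformedLaw.

(** * Growth of the informed set in one round *)

Lemma card_next_informed (V : finType) (k : nat) (I : {set V})
    (o : {ffun V * 'I_k -> V}) :
  (#|next_informed I o| <= k.+1 * #|I| + \sum_i (o i \in I))%N.
Proof.
rewrite /next_informed /push_pull_round.
apply: leq_trans (leq_card_setU _ _) _; rewrite mulSn.
apply: leq_add.
  apply: leq_trans (leq_card_setU _ _) _; rewrite leq_add2l.
  have sub : pushed I (fun v j => o (v, j)) \subset o @: finset.setX I [set: 'I_k]%SET.
    apply/fintype.subsetP => u; rewrite inE => /exists_inP[v vI /existsP[j /eqP <-]].
    by apply/imsetP; exists (v, j); rewrite // finset.in_setX vI inE.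
  apply: leq_trans (subset_leq_card sub) _.
  by apply: leq_trans (leq_imset_card _ _) _; rewrite finset.cardsX cardsT card_ord mulnC.
(* Each pulled node is charged to one of its own samples that hits [I]. Hits by informed nodes are
   counted too, which keeps the sum over all independent samples. *)
have -> : (\sum_i (o i \in I) = #|[set i | o i \in I]%SET|)%N.
  by rewrite -sum1dep_card [RHS]big_mkcond /=; apply: eq_bigr => i _; case: (_ \in _).
have sub : pulled I (fun v j => o (v, j)) \subset fst @: [set i | o i \in I]%SET.
  apply/fintype.subsetP => u; rewrite inE => /andP[_ /existsP[j oI]].
  by apply/imsetP; exists (u, j); rewrite // inE.
by apply: leq_trans (subset_leq_card sub) _; exact: leq_imset_card.
Qed.

(** From [exp (-x) >= 1 - x] follows [exp x <= 1 / (1 - x)], which is at most [1 + 2 x] on this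
    interval. *)
Lemma expR_le1D2x (R : realType) (x : R) : 0 <= x -> x <= 1 / 2 ->
  expR x <= 1 + 2 * x.
Proof.
move=> x0 x2; have h := expR_ge1Dx (- x); rewrite expRN in h.
have e0 := expR_gt0 x.
have : (1 - x) * expR x <= 1 by rewrite -ler_pdivlMr // div1r.
nra.
Qed.

Section OneRound.
Variables (R : realType) (V : finType) (k : nat).
Hypothesis V_ge2 : (2 <= #|V|)%N.

Let p := sample_prob R (@complete_graph V).

Lemma card_complete_neighbors (v : V) : #|complete_graph v| = #|V|.-1.
Proof.
rewrite -(cardC1 v); apply: eq_card => u.
by rewrite !inE /complete_graph /in_mem /= eq_sym.
Qed.

Lemma sample_prob_ge0 v u : 0 <= p v u.
Proof. by rewrite /p /sample_prob; case: ifP => //; rewrite invr_ge0. Qed.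

Lemma sample_prob_le v u : p v u <= (#|V|.-1%:R)^-1.
Proof.
rewrite /p /sample_prob card_complete_neighbors.
by case: ifP => // _; rewrite invr_ge0.
Qed.

Lemma sum_sample_prob v : \sum_u p v u = 1.
Proof.
rewrite /p /sample_prob -big_mkcond /= (sumr_const (complete_graph v)).
rewrite card_complete_neighbors -[LHS]mulr_natr mulVf // pnatr_eq0 -lt0n.
by rewrite -ltnS prednK // ltnW.
Qed.

Lemma sample_mgf (l : R) (I : {set V}) v : 0 <= l -> l <= 1 / 2 ->
  \sum_u p v u * expR (l * (u \in I)%:R)
  <= expR (2 * l * #|I|%:R / #|V|.-1%:R).
Proof.
move=> l0 l2; apply: le_trans (expR_ge1Dx _).
have bnd u : p v u * expR (l * (u \in I)%:R)
    <= p v u + (if u \in I then 2 * l / #|V|.-1%:R else 0).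
  case: (u \in I); rewrite ?mulr0 ?expR0 ?mulr1 ?addr0 //.
  apply: le_trans (ler_wpM2l (sample_prob_ge0 v u) (expR_le1D2x l0 l2)) _.
  rewrite mulrDr mulr1 lerD2l mulrC ler_wpM2l ?sample_prob_le //.
  exact: mulr_ge0.
apply: le_trans (ler_sum _ (fun u _ => bnd u)) _.
rewrite big_split /= sum_sample_prob lerD2l -big_mkcond /= sumr_const.
by rewrite -[leLHS]mulr_natr mulrAC.
Qed.

(** The factor [1 + 5 k] is [k + 1] for the informed nodes and their pushes, plus [4 k] for the
    pulls: [n k] samples, each contributing at most [2 l #|I| / (n - 1)] to the exponent, with
    [n / (n - 1) <= 2]. *)
Lemma next_informed_mgf (l : R) (I : {set V}) : 0 <= l -> l <= 1 / 2 ->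
  \sum_(o : {ffun V * 'I_k -> V})
     (\prod_i p i.1 (o i)) * expR (l * #|next_informed I o|%:R)
  <= expR (l * (1 + 5 * k%:R) * #|I|%:R).
Proof.
move=> l0 l2.
have bnd (o : {ffun V * 'I_k -> V}) :
    (\prod_i p i.1 (o i)) * expR (l * #|next_informed I o|%:R)
    <= expR (l * (k.+1%:R * #|I|%:R)) *
       \prod_i (p i.1 (o i) * expR (l * (o i \in I)%:R)).
  rewrite big_split /= mulrCA -expR_sum -expRD; apply: ler_wpM2l.
    by apply: prodr_ge0 => i _; exact: sample_prob_ge0.
  rewrite ler_expR -mulr_sumr -mulrDr; apply: ler_wpM2l => //.
  by rewrite -natr_sum -natrM -natrD ler_nat card_next_informed.
apply: le_trans (ler_sum _ (fun o _ => bnd o)) _.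
rewrite -mulr_sumr.
(* Independence in finite form: the sum over all outcomes of a product over samples is the product
   of the sums for single samples. *)
rewrite -(bigA_distr_bigA (fun (i : V * 'I_k) u => p i.1 u * expR (l * (u \in I)%:R))) /=.
set y := 2 * l * #|I|%:R / #|V|.-1%:R.
have : \prod_(i : V * 'I_k) \sum_u p i.1 u * expR (l * (u \in I)%:R)
       <= \prod_(i : V * 'I_k) expR y.
  apply: ler_prod => i _; rewrite sample_mgf // andbT.
  by apply: sumr_ge0 => u _; rewrite mulr_ge0 ?expR_ge0 ?sample_prob_ge0.
move=> /(ler_wpM2l (expR_ge0 (l * (k.+1%:R * #|I|%:R)))) /le_trans; apply.
rewrite prodr_const -expRM_natl -expRD ler_expR card_prod card_ord natrM.
have n2 : #|V|%:R / #|V|.-1%:R <= 2 :> R.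
  have := V_ge2; case: #|V| => [//|[//|m]] _ /=.
  by rewrite ler_pdivrMr ?ltr0n // -natrM ler_nat mul2n -addnn addSn ltnS leq_addl.
have c0 : 0 <= 2 * l * #|I|%:R * k%:R by rewrite !mulr_ge0.
have := ler_wpM2l c0 n2.
rewrite /y -natr1; set a := _ / _; move: c0.
rewrite (_ : #|V|%:R * k%:R * (2 * l * #|I|%:R / #|V|.-1%:R)
  = 2 * l * #|I|%:R * k%:R * a); last by rewrite /a; ring.
move=> _ h; apply: le_trans (lerD (lexx _) h) _.
by rewrite le_eqVlt; apply/orP; left; apply/eqP; ring.
Qed.

End OneRound.

(** * Exponential moments over several rounds and the tail bound *)

Section Growth.
Variables (R : realType) (d : measure_display) (T : measurableType d).
Variables (P : probability T R) (V : finType) (k : nat).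
Variables (X : nat -> V -> 'I_k -> T -> V) (s : V).
Hypothesis samplesX : neighbor_samples P (@complete_graph V) X.
Hypothesis V_ge2 : (2 <= #|V|)%N.

Definition informed_prob t B : R := fine (P (informed_event X s t B)).

Lemma informed_prob_ge0 t B : 0 <= informed_prob t B.
Proof. exact: fine_ge0. Qed.

Lemma informed_probE t B : P (informed_event X s t B) = (informed_prob t B)%:E.
Proof.
rewrite fineK // fin_num_measure //.
exact: (measurable_informed_event s samplesX).
Qed.

Definition informed_mgf t (l : R) :=
  \sum_(B : {set V}) informed_prob t B * expR (l * #|B|%:R).

Lemma informed_mgf0 l : informed_mgf 0 l = expR l.
Proof.
rewrite /informed_mgf (bigD1 [set s]%SET) //= big1 ?addr0 => [|B Bs].
  by rewrite /informed_prob informed_event0 eqxx probability_setT mul1r cards1 mulr1.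
by rewrite /informed_prob informed_event0 eq_sym (negPf Bs) measure0 mul0r.
Qed.

Lemma informed_mgf_step t l : 0 <= l -> l <= 1 / 2 ->
  informed_mgf t.+1 l <= informed_mgf t (l * (1 + 5 * k%:R)).
Proof.
move=> l0 l2; rewrite /informed_mgf.
pose w (q : {set V} * {ffun V * 'I_k -> V}) := informed_prob t q.1 *
  \prod_i sample_prob R (@complete_graph V) i.1 (q.2 i).
have law B : informed_prob t.+1 B
    = \sum_(q : {set V} * {ffun V * 'I_k -> V} | next_informed q.1 q.2 == B) w q.
  apply: EFin_inj; rewrite -informed_probE (informed_law s samplesX) -sumEFin.
  by apply: eq_bigr => q _; rewrite informed_probE.
have -> : \sum_B informed_prob t.+1 B * expR (l * #|B|%:R)
    = \sum_q w q * expR (l * #|next_informed q.1 q.2|%:R).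
  (* Pairs of a current set and an outcome are grouped by the next informed set they produce. *)
  rewrite [RHS](partition_big (fun q => next_informed q.1 q.2) predT) //=.
  apply: eq_bigr => B _; rewrite law mulr_suml.
  by apply: eq_bigr => q /eqP ->.
rewrite -(pair_bigA _ (fun I o => w (I, o) * expR (l * #|next_informed I o|%:R))) /=.
apply: ler_sum => I _; rewrite /w /=.
under eq_bigr do rewrite -mulrA.
rewrite -mulr_sumr; apply: ler_wpM2l; first exact: informed_prob_ge0.
exact: next_informed_mgf.
Qed.

(** Going back one round multiplies the parameter by [1 + 5 k >= 1]. Hence bounding the final
    parameter by 1/2 keeps all earlier ones in the range of the one-round estimate. *)
Lemma informed_mgf_le t l : 0 <= l -> l * (1 + 5 * k%:R) ^+ t <= 1 / 2 ->
  informed_mgf t l <= expR (l * (1 + 5 * k%:R) ^+ t).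
Proof.
elim: t l => [|t IH] l l0 lt; first by rewrite informed_mgf0 expr0 mulr1.
have a1 : 1 <= 1 + 5 * k%:R :> R by rewrite lerDl mulr_ge0.
rewrite exprS mulrA in lt *.
apply: le_trans (informed_mgf_step _ l0 _) (IH _ _ lt).
  apply: le_trans lt; rewrite -mulrA ler_peMr // -exprS exprn_ege1 //.
by rewrite mulr_ge0 // (le_trans ler01).
Qed.

(** Markov's inequality for the exponential moment: only the term of the full set is kept, and [l]
    is the largest parameter that [informed_mgf_le] admits. *)
Lemma all_informed_prob_le t :
  informed_prob t [set: V]%SET
  <= expR ((1 - #|V|%:R / (1 + 5 * k%:R) ^+ t) / 2).
Proof.
set A := _ ^+ t; have A0 : 0 < A by rewrite exprn_gt0 // ltr_pwDl // mulr_ge0.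
pose l := 1 / 2 / A.
have l0 : 0 <= l by rewrite /l !divr_ge0 // ltW.
have lA : l * A = 1 / 2 by rewrite /l divfK // gt_eqF.
have := informed_mgf_le (t := t) l0; rewrite -/A lA => /(_ (lexx _)) mgf.
have -> : (1 - #|V|%:R / A) / 2 = 1 / 2 - l * #|V|%:R.
  by rewrite /l; field; rewrite gt_eqF.
rewrite expRD expRN ler_pdivlMr ?expR_gt0 //; apply: le_trans mgf.
rewrite /informed_mgf (bigD1 [set: V]%SET) //= cardsT lerDl.
by apply: sumr_ge0 => B _; rewrite mulr_ge0 ?expR_ge0 ?informed_prob_ge0.
Qed.

End Growth.

(** * From the spreading time to the informed set at one fixed round *)

Lemma informed_mono (V : finType) (k : nat) (s : V) (c : nat -> V -> 'I_k -> V)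
    (t t' : nat) : (t <= t')%N -> informed s c t \subset informed s c t'.
Proof.
elim: t' => [|t' IH]; first by rewrite leqn0 => /eqP ->.
rewrite leq_eqVlt => /predU1P[-> //|/IH sub]; apply: fintype.subset_trans sub _.
by rewrite /= /push_pull_round -finset.setUA finset.subsetUl.
Qed.

(** Round [m] is the last one strictly before time [x]. By monotonicity, completion before [x]
    amounts to completion at round [m]; a run that never completes has time [+oo] and satisfies both
    sides. *)
Lemma push_pull_time_ge (R : realType) (d : measure_display)
    (T : measurableType d) (V : finType) (k : nat)
    (X : nat -> V -> 'I_k -> T -> V) (s : V) (x : R) (m : nat) :
  (forall t : nat, (t%:R < x) = (t <= m)%N) ->
  [set w | (x%:E <= push_pull_time R X s w)%E]
  = ~` informed_event X s m [set: V]%SET.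
Proof.
move=> xm; apply/seteqP; split=> w /=.
  move=> /ereal_infP tge full; have mx : m%:R < x by rewrite xm.
  by have := tge m%:R%:E; rewrite lee_fin leNgt mx => /(_ _) /negP; apply => //; exists m.
move=> nfull; apply/ereal_infP => _ [t /= full <-].
rewrite lee_fin leNgt xm; apply/negP => tm; apply: nfull.
apply/eqP; rewrite -finset.subTset -full; exact: informed_mono.
Qed.

Lemma lt_nat_threshold (R : realType) (x : R) : 0 < x ->
  exists m : nat, forall t : nat, (t%:R < x) = (t <= m)%N.
Proof.
move=> x0; have ex : exists m : nat, x <= m%:R.
  exists (Num.truncn x).+1; have /andP[_ /ltW //] := truncn_itv (ltW x0).
(* The least natural number that is at least [x] is nonzero because [x > 0]; its predecessor is the
   threshold. *)
case: (ex_minnP ex) => -[|m] xm minm; first by rewrite leNgt x0 in xm.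
exists m => t; rewrite ltNge; case: (leqP t m) => tm.
  by apply/negP => /minm; rewrite ltnNge tm.
by apply/negbF/(le_trans xm); rewrite ler_nat.
Qed.

(** * Numerical estimates and the choice of the constant *)

Lemma growth_factor_le (R : realType) (k : nat) : (2 <= k)%N ->
  1 + 5 * k%:R <= k%:R ^+ 4 :> R.
Proof.
rewrite -(ler_nat R) => k2; rewrite (_ : k%:R ^+ 4 = k%:R * k%:R ^+ 3) ?exprS //.
(* The chain is [1 + 5 k <= 8 k <= k^4]. *)
have : 8 <= k%:R ^+ 3 :> R.
  by rewrite (_ : 8 = 2 ^+ 3) ?lerXn2r ?nnegrE //; ring.
nra.
Qed.

(* With y = exp (a / 4) the claim reads 1 + 2 c a <= y^2; use a <= 4 y and
   1 + 8 c <= y. *)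
Lemma expR_sqrt_le (R : realType) (c a : R) : 0 < c -> 4 * ln (1 + 8 * c) <= a ->
  expR ((1 - expR (a / 2)) / 2) <= expR (- c * a).
Proof.
move=> c0 La; rewrite ler_expR.
have y1 : 1 + 8 * c <= expR (a / 4).
  rewrite -[leLHS]lnK ?posrE ?ler_expR; last by rewrite addr_gt0 // mulr_gt0.
  lra.
have ya : a / 4 <= expR (a / 4) by apply: le_trans (expR_ge1Dx _); rewrite lerDr.
have -> : expR (a / 2) = expR (a / 4) * expR (a / 4).
  by rewrite -expRD; congr expR; field.
nra.
Qed.

Theorem lemma2p3 (R : realType) (c : R) (c_gt0 : 0 < c) :
  exists2 C : R, 0 < C &
    forall (n k : nat), (2 <= n)%N -> (2 <= k)%N ->
    forall (d : measure_display) (T : measurableType d) (P : probability T R)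
      (X : nat -> 'I_n -> 'I_k -> T -> 'I_n) (s : 'I_n),
      neighbor_samples P (@complete_graph 'I_n) X ->
      ((1 - n%:R `^ (- c))%:E <=
        P [set w | (C * (ln n%:R / ln k%:R))%:E <= push_pull_time R X s w])%E.
Proof.
pose L : R := ln (1 + 8 * c).
have L0 : 0 <= L by apply: ln_ge0; rewrite lerDl mulr_ge0 // ltW.
have D0 : 0 < 8 + 8 * L by rewrite ltr_pwDl // mulr_ge0.
(* The summand 8 gives [C <= 1/8], hence [k^(4 m) <= sqrt n]. The summand [8 * L] makes
   [ln n >= 4 * L] as soon as [x > 1], as [expR_sqrt_le] requires. *)
exists (8 + 8 * L)^-1; first by rewrite invr_gt0.
move=> n k n2 k2 d T P X s samplesX; set C := (_)^-1.
have C0 : 0 < C by rewrite invr_gt0.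
have DC : (8 + 8 * L) * C = 1 by rewrite mulfV // gt_eqF.
(* [expR_le1D2x] at its endpoint 1/2 gives [exp (1/2) <= 2]. *)
have ln2 : 1 / 2 <= ln 2 :> R.
  rewrite -[leLHS]expRK ler_ln ?posrE ?expR_gt0 //.
  by have := @expR_le1D2x R (1 / 2); lra.
have ln_ge (m : nat) : (2 <= m)%N -> ln 2 <= ln m%:R :> R.
  by move=> m2; rewrite ler_ln ?posrE ?ltr0n ?ler_nat // (leq_trans _ m2).
have lnk : 1 / 2 <= ln k%:R :> R by apply: le_trans ln2 (ln_ge _ k2).
have lnn : 1 / 2 <= ln n%:R :> R by apply: le_trans ln2 (ln_ge _ n2).
set x := C * _.
have x0 : 0 < x by rewrite /x mulr_gt0 // divr_gt0 //; lra.
have xk : x * ln k%:R = C * ln n%:R by rewrite /x -mulrA divfK //; lra.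
have [m xm] := lt_nat_threshold x0.
have mx : m%:R < x by rewrite xm.
rewrite (push_pull_time_ge X s xm) probability_setC; last first.
  exact: (measurable_informed_event s samplesX).
have V2 : (2 <= #|'I_n|)%N by rewrite card_ord.
rewrite (informed_probE s samplesX) -EFinB lee_fin lerD2l lerN2.
(* For [m = 0] only the source is informed, so the failure probability is 0. This covers every [n]
   too small for the tail bound. *)
have [m0|m_gt0] := posnP m.
  rewrite m0 /informed_prob informed_event0 eqEcard cardsT cards1.
  by rewrite leqNgt V2 andbF measure0 powR_ge0.
have x1 : 1 < x by apply: le_lt_trans mx; rewrite ler1n.
have Ln : 4 * L <= ln n%:R.
  have : ln k%:R < C * ln n%:R by rewrite -xk ltr_pMl //; lra.
  nra.
apply: le_trans (all_informed_prob_le s samplesX V2 m) _.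
rewrite /powR pnatr_eq0 gtn_eqF ?(leq_trans _ n2) //.
(* With [a = ln n], [exp (a / 2)] is [sqrt n], so it remains to show [sqrt n <= n / (1 + 5 k)^m]. *)
apply: le_trans (expR_sqrt_le c_gt0 Ln); rewrite ler_expR ler_pM2r //.
rewrite lerD2l lerN2 card_ord.
have A0 : 0 < (1 + 5 * k%:R) ^+ m :> R by rewrite exprn_gt0 // ltr_pwDl // mulr_ge0.
rewrite ler_pdivlMr //.
have k_pos : 0 < k%:R :> R by rewrite ltr0n (leq_trans _ k2).
have n_pos : 0 < n%:R :> R by rewrite ltr0n (leq_trans _ n2).
have Am : (1 + 5 * k%:R) ^+ m <= expR (ln n%:R / 2) :> R.
  apply: (@le_trans _ _ ((k%:R ^+ 4) ^+ m)).
    by rewrite lerXn2r ?nnegrE ?growth_factor_le ?exprn_ge0 // addr_ge0 ?mulr_ge0.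
  rewrite -exprM -{1}[k%:R]lnK ?posrE // -expRM_natl ler_expR natrM.
  (* The exponent satisfies [4 m ln k <= 4 x ln k = 4 C ln n <= ln n / 2]. *)
  have : m%:R * ln k%:R <= x * ln k%:R by rewrite ler_wpM2r ?ltW //; lra.
  rewrite xk => h; nra.
apply: le_trans (ler_wpM2l (expR_ge0 _) Am) _.
by rewrite -expRD -splitr lnK ?posrE.
Qed.
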